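(* Assume $A\ge \varepsilon^2/16$. Let $\phi^{-1},\phi^0\in\mathcal{G}_N$ with $\overline{\phi^{-1}}=\overline{\phi^0}$, and let $(\phi^k)_{k\ge -1}$ be generated by the scheme \[ \frac{\frac32\phi^{k+1}-2\phi^k+\frac12\phi^{k-1}}{\Delta t}=\Delta_N\mu_i^{k+1},\quad k\ge0, \] with either $i=1$ or $i=2$, where \[ \mu_1^{k+1}=-\nabla_N\cdot(|\nabla_N\phi^{k+1}|^2\nabla_N\phi^{k+1})+a\phi^{k+1}+2\Delta_N(2\phi^k-\phi^{k-1})-A\Delta t\,\Delta_N(\phi^{k+1}-\phi^k)+\Delta_N^2\phi^{k+1}, \] \[ \mu_2^{k+1}=-\nabla_N\cdot(|\nabla_N\phi^{k+1}|^2\nabla_N\phi^{k+1})-\varepsilon(2\phi^k-\phi^{k-1})-A\Delta t\,\Delta_N(\phi^{k+1}-\phi^k)+(1+\Delta_N)^2\phi^{k+1}. \] Define the modified energies \[ \mathcal{E}_{N,1}(\phi^{k+1},\phi^k)=E_N(\phi^{k+1})+\frac{1}{4\Delta t}\|\phi^{k+1}-\phi^k\|_{-1,N}^2+\|\nabla_N(\phi^{k+1}-\phi^k)\|_2^2, \] \[ \mathcal{E}_{N,2}(\phi^{k+1},\phi^k)=E_N(\phi^{k+1})+\frac{1}{4\Delta t}\|\phi^{k+1}-\phi^k\|_{-1,N}^2+\frac{\varepsilon}{2}\|\phi^{k+1}-\phi^k\|_2^2 . \] Then for $k\ge1$, the solution of scheme $i$ satisfies $\mathcal{E}_{N,i}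(\phi^{k+1},\phi^k)\le\mathcal{E}_{N,i}(\phi^k,\phi^{k-1})$.
   Context: Let $K\in\mathbb{N}$, $N=2K+1$, $h=1/N$, $\Omega=(0,1)^3$, grid points $(ih,jh,kh)$. $\mathcal{G}_N$ is the space of real grid functions on $\mathbb{Z}^3$ that are $N$-periodic in each index; $\langle f,g\rangle=h^3\sum_{i,j,k=0}^{N-1}f_{i,j,k}g_{i,j,k}$, $\|f\|_p=(h^3\sum|f_{i,j,k}|^p)^{1/p}$ (pointwise Euclidean norm for vector-valued grid functions), $\overline f=\langle f,1\rangle$, and $\mathring{\mathcal{G}}_N=\{f:\overline f=0\}$. Each $f\in\mathcal{G}_N$ has discrete Fourier expansion $f_{i,j,k}=\sum_{\ell,m,n=-K}^K\hat f_{\ell,m,n}\exp(2\pi\mathrm{i}(\ell x_i+my_j+nz_k))$; $\mathcal{D}_x$ multiplies coefficients by $2\pi\mathrm{i}\ell$ (similarly $\mathcal{D}_y,\mathcal{D}_z$), $\nabla_Nf=(\mathcal{D}_xf,\mathcal{D}_yf,\mathcal{D}_zf)$, $\nabla_N\cdot(f_1,f_2,f_3)=\mathcal{D}_xf_1+\mathcal{D}_yf_2+\mathcal{D}_zf_3$, $\Delta_N$ multiplies coefficients by $-4\pi^2(\ell^2+m^2+n^2)$; nonlinear products are pointwise. For $f\in\mathring{\mathcal{G}}_N$, $(-\Delta_N)^{-1}f$ is the zero-mean grid function with coefficients $\hat f_{\ell,m,n}/(4\pi^2(\ell^2+m^2+n^2))$ for $(\ell,m,n)\ne0$, and $\|f\|_{-1,N}=\langle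 f,(-\Delta_N)^{-1}f\rangle^{1/2}$. The discrete energy is $E_N(\phi)=\frac14\|\nabla_N\phi\|_4^4+\frac a2\|\phi\|_2^2-\|\nabla_N\phi\|_2^2+\frac12\|\Delta_N\phi\|_2^2$. Parameters: $\Delta t>0$, $0<\varepsilon<1$, $a=1-\varepsilon>0$, $A$ a constant. *)

(* Defs.v *)
From HB Require Import structures.
From Stdlib Require Import Reals.
From mathcomp Require Import all_boot all_order all_algebra.
From mathcomp Require Import Rstruct complex.
Set Implicit Arguments. Unset Strict Implicit. Unset Printing Implicit Defensive.
Import Order.TTheory GRing.Theory Num.Theory.
Local Open Scope ring_scope.
Local Open Scope complex_scope.

Definition Ngrid (K : nat) : nat := (K.*2).+1.
Definition hgrid (K : nat) : R := ((Ngrid K)%:R)^-1.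

(* A grid function in G_N: N-periodic in each index, hence determined by its
   values at indices 0..N-1. *)
Definition gf (K : nat) := 'I_(Ngrid K) -> 'I_(Ngrid K) -> 'I_(Ngrid K) -> R.
Definition vgf (K : nat) := (gf K * gf K * gf K)%type.

Definition gadd K (f g : gf K) : gf K := fun i j k => f i j k + g i j k.
Definition gsub K (f g : gf K) : gf K := fun i j k => f i j k - g i j k.
Definition gscale K (c : R) (f : gf K) : gf K := fun i j k => c * f i j k.
Definition gmul K (f g : gf K) : gf K := fun i j k => f i j k * g i j k.
Definition gconst K (c : R) : gf K := fun _ _ _ => c.

(* the frequency ell in {-K..K} attached to p : 'I_N (ell = p - K) *)
Definition freq K (p : 'I_(Ngrid K)) : R := p%:R - K%:R.

Definition cexp (t : R) : R[i] := (cos t) +i* (sin t).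

Definition phase K (p q r i j k : 'I_(Ngrid K)) : R :=
  2 * PI * (freq p * (i%:R * hgrid K) + freq q * (j%:R * hgrid K)
            + freq r * (k%:R * hgrid K)).

(* discrete Fourier coefficients \hat f_{ell,m,n} (ell = freq p, ...):
   f_{i,j,k} = sum_{p,q,r} \hat f_{p,q,r} exp(2 pi i (ell x_i + m y_j + n z_k)) *)
Definition dft K (f : gf K) (p q r : 'I_(Ngrid K)) : R[i] :=
  ((hgrid K) ^+ 3)%:C *
  \sum_(i < Ngrid K) \sum_(j < Ngrid K) \sum_(k < Ngrid K)
     (f i j k)%:C * cexp (- phase p q r i j k).

Definition idft K (c : 'I_(Ngrid K) -> 'I_(Ngrid K) -> 'I_(Ngrid K) -> R[i]) : gf K :=
  fun i j k => complex.Re (\sum_(p < Ngrid K) \sum_(q < Ngrid K) \sum_(r < Ngrid K)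
                     c p q r * cexp (phase p q r i j k)).

Definition fmult K (s : 'I_(Ngrid K) -> 'I_(Ngrid K) -> 'I_(Ngrid K) -> R[i])
  (f : gf K) : gf K := idft (fun p q r => s p q r * dft f p q r).

Definition Dx K (f : gf K) : gf K := fmult (fun p q r => (2 * PI * freq p) *i) f.
Definition Dy K (f : gf K) : gf K := fmult (fun p q r => (2 * PI * freq q) *i) f.
Definition Dz K (f : gf K) : gf K := fmult (fun p q r => (2 * PI * freq r) *i) f.

Definition symb K (p q r : 'I_(Ngrid K)) : R :=
  4 * PI ^+ 2 * (freq p ^+ 2 + freq q ^+ 2 + freq r ^+ 2).

Definition Lap K (f : gf K) : gf K := fmult (fun p q r => (- symb p q r)%:C) f.

(* (-Delta_N)^{-1}: zero mean output, coefficient \hat f / (4 pi^2 (l^2+m^2+n^2)) *)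
Definition invmLap K (f : gf K) : gf K :=
  fmult (fun p q r => if [&& freq p == 0, freq q == 0 & freq r == 0] then 0
                      else ((symb p q r)^-1)%:C) f.

Definition grad K (f : gf K) : vgf K := (Dx f, Dy f, Dz f).
Definition dive K (v : vgf K) : gf K := gadd (gadd (Dx v.1.1) (Dy v.1.2)) (Dz v.2).

Definition inner K (f g : gf K) : R :=
  hgrid K ^+ 3 * \sum_(i < Ngrid K) \sum_(j < Ngrid K) \sum_(k < Ngrid K)
     f i j k * g i j k.
Definition norm2 K (f : gf K) : R := Num.sqrt (inner f f).
Definition mean K (f : gf K) : R := inner f (@gconst K 1).
Definition vsq K (v : vgf K) : gf K :=
  gadd (gadd (gmul v.1.1 v.1.1) (gmul v.1.2 v.1.2)) (gmul v.2 v.2).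
Definition vnorm2 K (v : vgf K) : R :=
  Num.sqrt (hgrid K ^+ 3 * \sum_(i < Ngrid K) \sum_(j < Ngrid K) \sum_(k < Ngrid K)
              vsq v i j k).
Definition vnorm4 K (v : vgf K) : R :=
  Num.sqrt (Num.sqrt (hgrid K ^+ 3 * \sum_(i < Ngrid K) \sum_(j < Ngrid K)
              \sum_(k < Ngrid K) (vsq v i j k) ^+ 2)).
Definition normm1 K (f : gf K) : R := Num.sqrt (inner f (invmLap f)).

Definition EN K (a : R) (phi : gf K) : R :=
  4^-1 * vnorm4 (grad phi) ^+ 4 + a / 2 * norm2 phi ^+ 2
  - vnorm2 (grad phi) ^+ 2 + 2^-1 * norm2 (Lap phi) ^+ 2.

Definition nonlin K (f : gf K) : gf K :=
  let g := grad f in let w := vsq g in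
  dive (gmul w g.1.1, gmul w g.1.2, gmul w g.2).

Definition onepLap K (f : gf K) : gf K := gadd f (Lap f).

(* chemical potentials; arguments: phi^{k+1}, phi^k, phi^{k-1}; a = 1 - eps *)
Definition mu1 K (eps A dt : R) (pn p pp : gf K) : gf K :=
  gadd (gadd (gadd (gadd (gscale (-1) (nonlin pn)) (gscale (1 - eps) pn))
                   (gscale 2 (Lap (gsub (gscale 2 p) pp))))
             (gscale (- (A * dt)) (Lap (gsub pn p))))
       (Lap (Lap pn)).

Definition mu2 K (eps A dt : R) (pn p pp : gf K) : gf K :=
  gadd (gadd (gadd (gscale (-1) (nonlin pn)) (gscale (- eps) (gsub (gscale 2 p) pp)))
             (gscale (- (A * dt)) (Lap (gsub pn p))))
       (onepLap (onepLap pn)).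

Definition mu K (idx : nat) (eps A dt : R) (pn p pp : gf K) : gf K :=
  if idx == 1%N then mu1 eps A dt pn p pp else mu2 eps A dt pn p pp.

Definition modE1 K (eps dt : R) (pn p : gf K) : R :=
  EN (1 - eps) pn + (4 * dt)^-1 * normm1 (gsub pn p) ^+ 2
  + vnorm2 (grad (gsub pn p)) ^+ 2.
Definition modE2 K (eps dt : R) (pn p : gf K) : R :=
  EN (1 - eps) pn + (4 * dt)^-1 * normm1 (gsub pn p) ^+ 2
  + eps / 2 * norm2 (gsub pn p) ^+ 2.
Definition modE K (idx : nat) (eps dt : R) (pn p : gf K) : R :=
  if idx == 1%N then modE1 eps dt pn p else modE2 eps dt pn p.

(* Main.v *)
Require Import Defs.
From HB Require Import structures.
From Stdlib Require Import Reals FunctionalExtensionality.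
From mathcomp Require Import all_boot all_order all_algebra.
From mathcomp Require Import Rstruct complex ring lra.
Import Order.TTheory GRing.Theory Num.Theory.
Local Open Scope ring_scope.
Local Open Scope complex_scope.

(** Fourier multipliers form a commutative algebra: by the orthogonality of the
    discrete characters, composition multiplies the (Hermitian) symbols and the
    adjoint conjugates them.  Hence the discrete derivatives are skew-adjoint,
    [Lap] is their sum of squares, and [- Lap] is inverted by [invmLap] on
    zero-mean functions; the scheme propagates the mean, so the increments
    [d = phi^{k+1} - phi^k] and [d' = phi^k - phi^{k-1}] have mean zero.

    Testing the scheme with [u = invmLap d] gives
    [<mu, d> = - (3/2 <d, u> - 1/2 <d', u>) / dt], while convexity of the quartic
    term and polarization of the quadratic ones bound [<mu, d>] from below by the
    increment of the energy.  For both schemes the dissipation left over is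
    nonnegative because of [|d + Lap d|^2 >= 0] and the interpolation inequality
    [eps/2 |d|^2 <= |d|_{-1}^2 / dt + A dt |grad d|^2], which is where
    [A >= eps^2 / 16] enters. *)

(* Definitions whose type or argument type is [R] are otherwise parsed in
   [R_scope]: the bodies in [Defs] are stated with [Rplus], [Rmult] and [IZR].
   Lemmas such as [freqE], [phaseE] and [symbE] restate them with the ring
   operations, so that [rewrite] and [ring] apply. *)
Local Bind Scope ring_scope with R.
Local Arguments cos x%_ring_scope.
Local Arguments cexp t%_ring_scope : simpl never.
Local Arguments conjc {R} x : simpl never.
Local Arguments sin x%_ring_scope.

(** * Discrete characters *)

Lemma cexpD (s t : R) : cexp (s + t) = cexp s * cexp t.
Proof.
rewrite /cexp -RplusE cos_plus sin_plus; simpc.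
by congr (_ +i* _); rewrite addrC.
Qed.

Lemma cexp0 : cexp 0 = 1.
Proof. by rewrite /cexp cos_0 sin_0. Qed.

Lemma cexpN (t : R) : cexp (- t) = conjc (cexp t).
Proof. by rewrite /cexp -RoppE cos_neg sin_neg. Qed.

Lemma cexp_mulr_nat (t : R) (n : nat) : cexp (t * n%:R) = cexp t ^+ n.
Proof.
elim: n => [|n IHn]; first by rewrite mulr0 cexp0.
by rewrite mulrS mulrDr mulr1 cexpD IHn exprS.
Qed.

Lemma cexp_2PI : cexp (2 * PI) = 1.
Proof. by have := cos_2PI; have := sin_2PI; rewrite /cexp => -> ->. Qed.

Lemma cexp_double_eq1 (t : R) : cexp (2 * t) = 1 -> sin t = 0.
Proof.
case=> cos1 _; have cos2 : cos (2 * t) = 1 - 2 * sin t * sin t.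
  exact: cos_2a_sin.
apply/eqP; rewrite -sqrf_eq0 expr2; apply/eqP; lra.
Qed.

Lemma Ngrid_gt0 (K : nat) : 0 < (Ngrid K)%:R :> R.
Proof. by rewrite ltr0n. Qed.

(* Since [cexp (2 t) = 1] forces [sin t = 0], the ratio of the geometric sum is
   different from 1 as soon as [0 < |m - n| < N]. *)
Lemma sum_cexp (K : nat) (m n : 'I_(Ngrid K)) :
  \sum_(i < Ngrid K) cexp (2 * PI * ((m%:R - n%:R) * hgrid K)) ^+ i
  = (if m == n then (Ngrid K)%:R else 0) :> R[i].
Proof.
have [->|neq_mn] := eqVneq m n.
  rewrite subrr mul0r mulr0 cexp0 (eq_bigr (fun=> 1)) => [|i _]; last exact: expr1n.
  by rewrite sumr_const card_ord.
set w := cexp _.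
suff w1 : w != 1.
  have wN : w ^+ Ngrid K = 1.
    rewrite -cexp_mulr_nat /hgrid.
    have -> : 2 * PI * ((m%:R - n%:R) * (Ngrid K)%:R^-1) * (Ngrid K)%:R
       = 2 * PI * m%:R - 2 * PI * n%:R.
      rewrite -!mulrA mulVf ?mulr1; last by rewrite gt_eqF ?Ngrid_gt0.
      by ring.
    by rewrite cexpD cexpN !cexp_mulr_nat cexp_2PI !expr1n conjc1 mulr1.
  (* The factorization of [w ^+ N - 1] by [w - 1] has zero left side, so the geometric sum vanishes
     once [w != 1]. *)
  have /eqP := subrX1 w (Ngrid K); rewrite wN subrr eq_sym mulf_eq0 subr_eq0.
  by rewrite (negPf w1) => /eqP.
have sin_pos (a b : 'I_(Ngrid K)) : (a < b)%N ->
    sin (PI * ((b%:R - a%:R) * hgrid K)) != 0.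
  move=> lt_ab; have PI0 : 0 < PI by apply/RltP/PI_RGT_0.
  have d0 : 0 < (b%:R - a%:R) * hgrid K.
    by rewrite mulr_gt0 ?subr_gt0 ?ltr_nat // invr_gt0 Ngrid_gt0.
  have d1 : (b%:R - a%:R) * hgrid K < 1.
    rewrite /hgrid ltr_pdivrMr ?Ngrid_gt0 // mul1r.
    apply: le_lt_trans (_ : b%:R < _); first by rewrite gerBl ler0n.
    by rewrite ltr_nat.
  rewrite gt_eqF //; apply/RltP/sin_gt_0; apply/RltP.
    exact: mulr_gt0.
  by rewrite gtr_pMr.
apply/eqP; rewrite /w -mulrA => /cexp_double_eq1 /eqP; apply/negP.
move: neq_mn; rewrite -val_eqE /= neq_ltn => /orP[] /sin_pos //.
by rewrite -opprB mulNr mulrN -RoppE sin_neg RoppE oppr_eq0.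
Qed.

Lemma freqE (K : nat) (p : 'I_(Ngrid K)) : freq p = p%:R - K%:R.
Proof. by []. Qed.

Lemma phaseE (K : nat) (p q r i j k : 'I_(Ngrid K)) :
  phase p q r i j k = 2 * PI * (freq p * (i%:R * hgrid K)
    + freq q * (j%:R * hgrid K) + freq r * (k%:R * hgrid K)).
Proof. by []. Qed.

Definition char1 (K : nat) (p i : 'I_(Ngrid K)) : R[i] :=
  cexp (2 * PI * (freq p * (i%:R * hgrid K))).

Lemma char1_orth_grid (K : nat) (p q : 'I_(Ngrid K)) :
  \sum_i char1 K p i * conjc (char1 K q i) = if p == q then (Ngrid K)%:R else 0.
Proof.
rewrite -sum_cexp; apply: eq_bigr => i _.
rewrite /char1 -cexpN -cexpD -cexp_mulr_nat !freqE; congr cexp; ring.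
Qed.

(** Unlike in the sum over grid points, the shift by [K] in [freq] does not cancel here: it leaves a
    constant phase in front of the geometric sum, equal to 1 when [i = j]. *)
Lemma char1_orth_freq (K : nat) (i j : 'I_(Ngrid K)) :
  \sum_p char1 K p i * conjc (char1 K p j) = if i == j then (Ngrid K)%:R else 0.
Proof.
transitivity (cexp (- (K%:R * (2 * PI * ((i%:R - j%:R) * hgrid K)))) *
  \sum_(p < Ngrid K) cexp (2 * PI * ((i%:R - j%:R) * hgrid K)) ^+ p).
  rewrite mulr_sumr; apply: eq_bigr => p _.
  rewrite /char1 -cexpN -cexpD -cexp_mulr_nat -cexpD !freqE; congr cexp; ring.
rewrite sum_cexp; case: eqP => [->|_]; last by rewrite mulr0.
by rewrite subrr !(mul0r, mulr0) oppr0 cexp0 mul1r.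
Qed.

Notation idx3 K := ('I_(Ngrid K) * 'I_(Ngrid K) * 'I_(Ngrid K))%type.

(** Uncurried evaluation turns triple sums into sums over one finite type, where exchange,
    reindexing and isolation of a term are single steps. *)
Definition at3 (K : nat) (S : Type)
  (f : 'I_(Ngrid K) -> 'I_(Ngrid K) -> 'I_(Ngrid K) -> S) (x : idx3 K) : S :=
  f x.1.1 x.1.2 x.2.

Lemma sum3E (K : nat) (V : nmodType)
    (F : 'I_(Ngrid K) -> 'I_(Ngrid K) -> 'I_(Ngrid K) -> V) :
  \sum_i \sum_j \sum_k F i j k = \sum_x at3 K V F x.
Proof. by rewrite pair_bigA /= pair_bigA. Qed.

Lemma at3_ext (K : nat) (S : Type)
    (f g : 'I_(Ngrid K) -> 'I_(Ngrid K) -> 'I_(Ngrid K) -> S) :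
  at3 K S f =1 at3 K S g -> f = g.
Proof.
move=> fg; do 3![apply: functional_extensionality => ?].
by match goal with |- f ?i ?j ?k = _ => exact: (fg (i, j, k)) end.
Qed.

Definition char3 (K : nat) (w x : idx3 K) : R[i] :=
  cexp (phase w.1.1 w.1.2 w.2 x.1.1 x.1.2 x.2).

Lemma char3E (K : nat) (w x : idx3 K) :
  char3 K w x = char1 K w.1.1 x.1.1 * char1 K w.1.2 x.1.2 * char1 K w.2 x.2.
Proof. by rewrite /char1 -!cexpD /char3 phaseE !mulrDr. Qed.

Lemma sum_prod3 (I J L : finType) (S : comPzRingType) (f : I -> S) (g : J -> S)
    (h : L -> S) :
  \sum_(x : I * J * L) f x.1.1 * g x.1.2 * h x.2
  = (\sum_i f i) * (\sum_j g j) * (\sum_k h k).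
Proof.
rewrite big_distrlr /= pair_bigA /= big_distrlr /= pair_bigA /=.
by apply: eq_bigr => -[[]].
Qed.

Lemma if_prod3 (K : nat) (x y : idx3 K) (a : R[i]) :
  (if x.1.1 == y.1.1 then a else 0) * (if x.1.2 == y.1.2 then a else 0)
    * (if x.2 == y.2 then a else 0) = if x == y then a ^+ 3 else 0.
Proof.
case: x y => [[x1 x2] x3] [[y1 y2] y3] /=; rewrite !xpair_eqE.
case: (x1 == y1); case: (x2 == y2); case: (x3 == y3);
  by rewrite ?(mul0r, mulr0) // !exprS expr0 mulr1 mulrA.
Qed.

Lemma char3_orth_grid (K : nat) (w v : idx3 K) :
  \sum_x char3 K w x * conjc (char3 K v x) = if w == v then (Ngrid K)%:R ^+ 3 else 0.
Proof.
rewrite -if_prod3 -!char1_orth_grid -sum_prod3; apply: eq_bigr => x _.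
by rewrite !char3E !rmorphM /=; ring.
Qed.

Lemma char3_orth_freq (K : nat) (x y : idx3 K) :
  \sum_w char3 K w x * conjc (char3 K w y) = if x == y then (Ngrid K)%:R ^+ 3 else 0.
Proof.
rewrite -if_prod3 -!char1_orth_freq -sum_prod3; apply: eq_bigr => w _.
by rewrite !char3E !rmorphM /=; ring.
Qed.

(** * Fourier multipliers *)

Lemma innerE (K : nat) (f g : gf K) :
  inner f g = hgrid K ^+ 3 * \sum_x at3 K R f x * at3 K R g x.
Proof. by congr (_ * _); exact: sum3E. Qed.

Lemma dftE (K : nat) (f : gf K) (w : idx3 K) :
  at3 K _ (dft f) w
  = (hgrid K ^+ 3)%:C * \sum_x (at3 K R f x)%:C * conjc (char3 K w x).
Proof.
congr (_ * _); apply: etrans; first exact: sum3E.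
by apply: eq_bigr => x _; rewrite /at3 cexpN.
Qed.

Lemma fmultE (K : nat) s (f : gf K) (x : idx3 K) :
  at3 K R (fmult s f) x
  = complex.Re (\sum_w at3 K _ s w * at3 K _ (dft f) w * char3 K w x).
Proof. by congr complex.Re; exact: sum3E. Qed.

(** Real matrix of the multiplier with symbol [s]. Since [idft] takes a real part and [f] is real,
    linearity and the adjoint formula become facts about this matrix, valid for arbitrary
    symbols. *)
Definition kernel (K : nat) s (x y : idx3 K) : R :=
  hgrid K ^+ 3 * complex.Re (\sum_w at3 K _ s w * char3 K w x * conjc (char3 K w y)).

Lemma Re_sum (I : finType) (F : I -> R[i]) :
  complex.Re (\sum_i F i) = \sum_i complex.Re (F i).
Proof. exact: (raddf_sum (@complex.Re R)). Qed.

Lemma Re_realM (a : R) (z : R[i]) : complex.Re (a%:C * z) = a * complex.Re z.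
Proof. by case: z => x y /=; rewrite mul0r subr0. Qed.

Lemma fmult_kernel (K : nat) s (f : gf K) (x : idx3 K) :
  at3 K R (fmult s f) x = \sum_y kernel K s x y * at3 K R f y.
Proof.
rewrite fmultE; transitivity (complex.Re (\sum_y (hgrid K ^+ 3 * at3 K R f y)%:C *
  (\sum_w at3 K _ s w * char3 K w x * conjc (char3 K w y)))).
  congr complex.Re; under [RHS]eq_bigr do rewrite mulr_sumr.
  rewrite exchange_big /=; apply: eq_bigr => w _.
  rewrite dftE !mulr_sumr mulr_suml; apply: eq_bigr => y _.
  by rewrite [in RHS]rmorphM /=; ring.
rewrite Re_sum; apply: eq_bigr => y _; rewrite Re_realM /kernel; ring.
Qed.

Lemma fmultD (K : nat) s (f g : gf K) :
  fmult s (gadd f g) = gadd (fmult s f) (fmult s g).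
Proof.
apply: at3_ext => x; rewrite fmult_kernel.
transitivity (at3 K R (fmult s f) x + at3 K R (fmult s g) x); last by [].
rewrite !fmult_kernel -big_split /=; apply: eq_bigr => y _.
by rewrite -mulrDr.
Qed.

Lemma fmultZ (K : nat) s (c : R) (f : gf K) :
  fmult s (gscale c f) = gscale c (fmult s f).
Proof.
apply: at3_ext => x; rewrite fmult_kernel.
transitivity (c * at3 K R (fmult s f) x); last by [].
by rewrite fmult_kernel mulr_sumr; apply: eq_bigr => y _; rewrite mulrCA.
Qed.

(** Exchanging [x] and [y] while conjugating the symbol conjugates each term of the sum, which the
    real part does not see. *)
Lemma kernel_conj (K : nat) s (x y : idx3 K) :
  kernel K (fun p q r => conjc (s p q r)) x y = kernel K s y x.
Proof.
congr (_ * _); rewrite !Re_sum; apply: eq_bigr => w _.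
have Re_conj (z : R[i]) : complex.Re (conjc z) = complex.Re z by case: z.
rewrite -Re_conj !rmorphM /= !conjcK /at3; congr complex.Re; ring.
Qed.

Lemma fmult_adjoint (K : nat) s (f g : gf K) :
  inner (fmult s f) g = inner f (fmult (fun p q r => conjc (s p q r)) g).
Proof.
rewrite !innerE; congr (_ * _).
under eq_bigr do rewrite fmult_kernel mulr_suml.
under [RHS]eq_bigr do rewrite fmult_kernel mulr_sumr.
rewrite exchange_big /=; apply: eq_bigr => y _; apply: eq_bigr => x _.
by rewrite kernel_conj mulrCA mulrA.
Qed.

Lemma fmult_symbolD (K : nat) s t (f : gf K) :
  fmult (fun p q r => s p q r + t p q r) f = gadd (fmult s f) (fmult t f).
Proof.
apply: at3_ext => x; rewrite fmultE.
transitivity (at3 K R (fmult s f) x + at3 K R (fmult t f) x); last by [].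
rewrite !fmultE -[RHS](raddfD (@complex.Re R)) -big_split /=.
by congr complex.Re; apply: eq_bigr => w _; rewrite -!mulrDl.
Qed.

Lemma fmult_symbolZ (K : nat) (c : R) s (f : gf K) :
  fmult (fun p q r => c%:C * s p q r) f = gscale c (fmult s f).
Proof.
apply: at3_ext => x; rewrite fmultE.
transitivity (c * at3 K R (fmult s f) x); last by [].
rewrite fmultE -Re_realM mulr_sumr.
by congr complex.Re; apply: eq_bigr => w _; rewrite !mulrA.
Qed.

(** Symbols are compared only after multiplication by the coefficients, so they may differ at
    frequency zero when [f] has mean zero. *)
Lemma eq_fmult (K : nat) s t (f : gf K) :
  (forall p q r, s p q r * dft f p q r = t p q r * dft f p q r) ->
  fmult s f = fmult t f.
Proof.
move=> st; apply: at3_ext => x; rewrite !fmultE.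
by congr complex.Re; apply: eq_bigr => w _; rewrite /at3 st.
Qed.

(** [rev_ord] negates the frequency, so this is the symmetry of the coefficients of a real grid
    function; under it the real part taken in [idft] loses nothing. *)
Definition hermitian (K : nat)
    (s : 'I_(Ngrid K) -> 'I_(Ngrid K) -> 'I_(Ngrid K) -> R[i]) :=
  forall p q r, s (rev_ord p) (rev_ord q) (rev_ord r) = conjc (s p q r).

Lemma freq_rev (K : nat) (p : 'I_(Ngrid K)) : freq (rev_ord p) = - freq p.
Proof.
rewrite !freqE /= natrB ?ltn_ord //.
have -> : (Ngrid K)%:R = 1 + (K%:R + K%:R) :> R.
  by rewrite -natrD addnn -(natrD _ 1).
by rewrite (mulrS _ p); ring.
Qed.

Definition rev3 (K : nat) (w : idx3 K) : idx3 K :=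
  (rev_ord w.1.1, rev_ord w.1.2, rev_ord w.2).

Lemma rev3K (K : nat) : involutive (rev3 K).
Proof. by move=> [[p q] r]; rewrite /rev3 /= !rev_ordK. Qed.

Lemma char3_rev (K : nat) (w x : idx3 K) : char3 K (rev3 K w) x = conjc (char3 K w x).
Proof. by rewrite -cexpN /char3 !phaseE !freq_rev; congr cexp; ring. Qed.

Lemma dft_hermitian (K : nat) (f : gf K) : hermitian K (dft f).
Proof.
move=> p q r.
have -> : dft f p q r = at3 K _ (dft f) (p, q, r) by [].
have -> : dft f (rev_ord p) (rev_ord q) (rev_ord r)
  = at3 K _ (dft f) (rev3 K (p, q, r)) by [].
rewrite !dftE [RHS]rmorphM /= rmorph_sum /= conjc_real; congr (_ * _).
by apply: eq_bigr => x _; rewrite [RHS]rmorphM /= conjc_real char3_rev.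
Qed.

(** Reindexing by [rev3] shows that the sum equals its own conjugate. *)
Lemma real_idft (K : nat) c (x : idx3 K) : hermitian K c ->
  (at3 K R (idft c) x)%:C = \sum_w at3 K _ c w * char3 K w x.
Proof.
move=> c_herm.
have -> : at3 K R (idft c) x = complex.Re (\sum_w at3 K _ c w * char3 K w x).
  by congr complex.Re; exact: sum3E.
set S := \sum_w _; suff : conjc S = S.
  by case: S => a b [] b0; congr (_ +i* _); lra.
rewrite /S rmorph_sum /= (reindex_inj (inv_inj (rev3K K))) /=.
apply: eq_bigr => w _; rewrite rmorphM /= char3_rev conjcK; congr (_ * _).
by rewrite /at3 /= c_herm conjcK.
Qed.

Lemma hgrid3K (K : nat) : (hgrid K ^+ 3)%:C * (Ngrid K)%:R ^+ 3 = 1.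
Proof.
rewrite rmorphXn -exprMn /= /hgrid.
have -> : (Ngrid K)%:R = ((Ngrid K)%:R)%:C :> R[i] by rewrite rmorph_nat.
by rewrite -rmorphM mulVf ?rmorph1 ?expr1n // gt_eqF ?Ngrid_gt0.
Qed.

Lemma dft_idft (K : nat) c : hermitian K c -> dft (idft c) = c.
Proof.
move=> c_herm; apply: at3_ext => w; rewrite dftE.
under eq_bigr do rewrite real_idft // mulr_suml.
rewrite exchange_big /= (bigD1 w) //= [X in _ + X]big1 ?addr0.
  under eq_bigr do rewrite -mulrA.
  by rewrite -mulr_sumr char3_orth_grid eqxx mulrCA hgrid3K mulr1.
move=> v neq_vw; under eq_bigr do rewrite -mulrA.
by rewrite -mulr_sumr char3_orth_grid (negPf neq_vw) mulr0.
Qed.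

Lemma dft_fmult (K : nat) s (f : gf K) : hermitian K s ->
  dft (fmult s f) = fun p q r => s p q r * dft f p q r.
Proof.
move=> s_herm; rewrite /fmult dft_idft //; move=> p q r.
by rewrite s_herm (dft_hermitian K f p q r) [RHS]rmorphM.
Qed.

(** The outer multiplier reads the coefficients of the inner output; [dft_fmult] gives them exactly
    when [t] is Hermitian. *)
Lemma fmult_comp (K : nat) s t (f : gf K) : hermitian K t ->
  fmult s (fmult t f) = fmult (fun p q r => s p q r * t p q r) f.
Proof.
move=> t_herm; apply: at3_ext => x; rewrite !fmultE (dft_fmult K t f t_herm).
by congr complex.Re; apply: eq_bigr => w _; rewrite /at3 !mulrA.
Qed.

(** Fourier inversion: orthogonality in the frequency makes [kernel] the identity matrix. *)
Lemma fmult1 (K : nat) (f : gf K) : fmult (fun _ _ _ => 1) f = f.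
Proof.
apply: at3_ext => x; rewrite fmult_kernel (bigD1 x) //= [X in _ + X]big1 ?addr0.
  rewrite /kernel -Re_realM; under eq_bigr do rewrite /at3 mul1r.
  by rewrite char3_orth_freq eqxx hgrid3K mul1r.
move=> y neq_yx; rewrite /kernel; under eq_bigr do rewrite /at3 mul1r.
by rewrite char3_orth_freq eq_sym (negPf neq_yx) mulr0 mul0r.
Qed.

Local Notation Dx := Defs.Dx.
Local Arguments gscale {K} c%_ring_scope f.
Local Arguments Lap : simpl never.

(** * Spectral derivatives *)

Lemma gsubE (K : nat) (f g : gf K) : gsub f g = gadd f (gscale (-1) g).
Proof.
apply: at3_ext => x; transitivity (at3 K R f x + -1 * at3 K R g x); last by [].
by rewrite mulN1r.
Qed.

Lemma innerC (K : nat) (f g : gf K) : inner f g = inner g f.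
Proof.
by rewrite !innerE; congr (_ * _); apply: eq_bigr => x _; rewrite mulrC.
Qed.

Lemma innerDl (K : nat) (f g h : gf K) :
  inner (gadd f g) h = inner f h + inner g h.
Proof.
rewrite !innerE -mulrDr -big_split; congr (_ * _); apply: eq_bigr => x _.
exact: mulrDl.
Qed.

Lemma innerZl (K : nat) (c : R) (f h : gf K) : inner (gscale c f) h = c * inner f h.
Proof.
rewrite !innerE mulrCA; congr (_ * _); rewrite mulr_sumr; apply: eq_bigr => x _.
exact/esym/mulrA.
Qed.

Lemma innerBl (K : nat) (f g h : gf K) :
  inner (gsub f g) h = inner f h - inner g h.
Proof. by rewrite gsubE innerDl innerZl mulN1r. Qed.

Lemma innerDr (K : nat) (f g h : gf K) :
  inner h (gadd f g) = inner h f + inner h g.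
Proof. by rewrite innerC innerDl !(innerC _ h). Qed.

Lemma innerZr (K : nat) (c : R) (f h : gf K) : inner h (gscale c f) = c * inner h f.
Proof. by rewrite innerC innerZl !(innerC _ h). Qed.

Lemma innerBr (K : nat) (f g h : gf K) :
  inner h (gsub f g) = inner h f - inner h g.
Proof. by rewrite innerC innerBl !(innerC _ h). Qed.

Definition inner_lin := (innerDl, innerDr, innerBl, innerBr, innerZl, innerZr).

Lemma hgrid_ge0 (K : nat) : 0 <= hgrid K ^+ 3.
Proof. by rewrite exprn_ge0 // invr_ge0 ler0n. Qed.

Lemma inner_ge0 (K : nat) (f : gf K) : 0 <= inner f f.
Proof.
rewrite innerE mulr_ge0 ?hgrid_ge0 //; apply: sumr_ge0 => x _.
by rewrite -expr2 sqr_ge0.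
Qed.

Lemma fmult_skew (K : nat) (a : 'I_(Ngrid K) -> 'I_(Ngrid K) -> 'I_(Ngrid K) -> R)
    (f g : gf K) :
  inner (fmult (fun p q r => (a p q r)*i) f) g
  = - inner f (fmult (fun p q r => (a p q r)*i) g).
Proof.
rewrite fmult_adjoint -mulN1r -innerZr -fmult_symbolZ; congr (inner _ _).
congr (fmult _ _); apply: at3_ext => w; rewrite /at3 /conjc; simpc.
by congr (_ +i* _); ring.
Qed.

Lemma fmult_imag_comp (K : nat)
    (a : 'I_(Ngrid K) -> 'I_(Ngrid K) -> 'I_(Ngrid K) -> R) (f : gf K) :
  (forall p q r, a (rev_ord p) (rev_ord q) (rev_ord r) = - a p q r) ->
  fmult (fun p q r => (a p q r)*i) (fmult (fun p q r => (a p q r)*i) f)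
  = fmult (fun p q r => (- a p q r ^+ 2)%:C) f.
Proof.
move=> a_odd; rewrite fmult_comp => [|p q r]; last by rewrite a_odd.
congr (fmult _ _); apply: at3_ext => w; rewrite /at3; simpc.
by rewrite expr2.
Qed.

(* [IZR 4] computes to [(1 + 1) * (1 + 1)], which is not convertible to [4%:R]. *)
Lemma IZR4 : IZR 4 = 4.
Proof. by transitivity ((1 + 1) * (1 + 1) : R) => //; ring. Qed.

Lemma symbE (K : nat) (p q r : 'I_(Ngrid K)) :
  symb p q r = 4 * PI ^+ 2 * (freq p ^+ 2 + freq q ^+ 2 + freq r ^+ 2).
Proof. by rewrite -IZR4. Qed.

Lemma LapE (K : nat) (f : gf K) :
  Lap f = gadd (gadd (Dx (Dx f)) (Dy (Dy f))) (Dz (Dz f)).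
Proof.
rewrite /Dx /Dy /Dz.
rewrite !fmult_imag_comp; try by move=> p q r; rewrite freq_rev mulrN.
rewrite -!fmult_symbolD; congr (fmult _ _); apply: at3_ext => w.
by rewrite /at3 symbE -!rmorphD; congr (_ %:C); rewrite !exprMn; ring.
Qed.

Lemma LapD (K : nat) (f g : gf K) : Lap (gadd f g) = gadd (Lap f) (Lap g).
Proof. exact: fmultD. Qed.

Lemma Lap_sym (K : nat) (f g : gf K) : inner (Lap f) g = inner f (Lap g).
Proof.
rewrite fmult_adjoint; congr (inner _ _); congr (fmult _ _); apply: at3_ext => w.
exact: conjc_real.
Qed.

(** Polarization of [vnorm2 (grad f) ^+ 2]. *)
Definition ginner (K : nat) (f g : gf K) : R :=
  inner (Dx f) (Dx g) + inner (Dy f) (Dy g) + inner (Dz f) (Dz g).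

Lemma inner_Lap (K : nat) (f g : gf K) : inner (Lap f) g = - ginner K f g.
Proof.
rewrite LapE !innerDl /ginner.
by rewrite {1}/Dx {1}/Dy {1}/Dz !fmult_skew !opprD.
Qed.

Lemma ginnerC (K : nat) (f g : gf K) : ginner K f g = ginner K g f.
Proof. by congr (_ + _ + _); exact: innerC. Qed.

Lemma ginnerDl (K : nat) (f g h : gf K) :
  ginner K (gadd f g) h = ginner K f h + ginner K g h.
Proof. by rewrite /ginner /Dx /Dy /Dz !fmultD !innerDl; ring. Qed.

Lemma ginnerZl (K : nat) (c : R) (f h : gf K) :
  ginner K (gscale c f) h = c * ginner K f h.
Proof. by rewrite /ginner /Dx /Dy /Dz !fmultZ !innerZl; ring. Qed.

Lemma ginnerBl (K : nat) (f g h : gf K) :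
  ginner K (gsub f g) h = ginner K f h - ginner K g h.
Proof. by rewrite gsubE ginnerDl ginnerZl mulN1r. Qed.

Lemma ginnerDr (K : nat) (f g h : gf K) :
  ginner K h (gadd f g) = ginner K h f + ginner K h g.
Proof. by rewrite ginnerC ginnerDl !(ginnerC _ h). Qed.

Lemma ginnerZr (K : nat) (c : R) (f h : gf K) :
  ginner K h (gscale c f) = c * ginner K h f.
Proof. by rewrite ginnerC ginnerZl !(ginnerC _ h). Qed.

Lemma ginnerBr (K : nat) (f g h : gf K) :
  ginner K h (gsub f g) = ginner K h f - ginner K h g.
Proof. by rewrite ginnerC ginnerBl !(ginnerC _ h). Qed.

Definition ginner_lin := (ginnerDl, ginnerDr, ginnerBl, ginnerBr, ginnerZl, ginnerZr).

Lemma ginner_ge0 (K : nat) (f : gf K) : 0 <= ginner K f f.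
Proof. by rewrite /ginner !addr_ge0 ?inner_ge0. Qed.

Lemma ginner_le (K : nat) (f g : gf K) :
  2 * ginner K f g <= ginner K f f + ginner K g g.
Proof.
have := ginner_ge0 K (gsub f g); rewrite !ginner_lin (ginnerC _ g f) => h; lra.
Qed.

Lemma inner_le (K : nat) (f g : gf K) : 2 * inner f g <= inner f f + inner g g.
Proof.
have := inner_ge0 K (gsub f g); rewrite !inner_lin (innerC _ g f) => h; lra.
Qed.

Lemma dft_freq0 (K : nat) (f : gf K) (p q r : 'I_(Ngrid K)) :
  freq p = 0 -> freq q = 0 -> freq r = 0 -> dft f p q r = (mean f)%:C.
Proof.
move=> p0 q0 r0; have -> : dft f p q r = at3 K _ (dft f) (p, q, r) by [].
rewrite dftE /mean innerE [RHS]rmorphM; congr (_ * _); rewrite rmorph_sum.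
apply: eq_bigr => x _; rewrite /char3 phaseE p0 q0 r0 !mul0r !addr0 mulr0 cexp0.
by rewrite conjc1 mulr1 /at3 /gconst mulr1.
Qed.

Lemma freq_eq0P (K : nat) : exists p : 'I_(Ngrid K), freq p = 0.
Proof.
have ltK : (K < Ngrid K)%N by rewrite ltnS -addnn leq_addr.
by exists (Ordinal ltK); rewrite freqE subrr.
Qed.

(** The mean is the coefficient at frequency zero, where the symbol of [Lap] vanishes. This is what
    makes the scheme propagate the mean. *)
Lemma mean_Lap (K : nat) (f : gf K) : mean (Lap f) = 0.
Proof.
have [p p0] := freq_eq0P K; apply: (@complexI R).
rewrite -(dft_freq0 K _ p p p) // dft_fmult => [|u v w].
  by rewrite symbE p0 expr0n /= !addr0 mulr0 oppr0 mul0r.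
by rewrite conjc_real !symbE !freq_rev !sqrrN.
Qed.

Lemma symb_neq0 (K : nat) (p q r : 'I_(Ngrid K)) :
  ~~ [&& freq p == 0, freq q == 0 & freq r == 0] -> symb p q r != 0.
Proof.
have PI0 : 0 < PI by apply/RltP/PI_RGT_0.
have c0 : 4 * PI ^+ 2 != 0 by rewrite gt_eqF // mulr_gt0 ?exprn_gt0.
apply: contraNneq => /eqP; rewrite symbE mulf_eq0 (negPf c0) /=.
rewrite paddr_eq0 ?addr_ge0 ?sqr_ge0 // paddr_eq0 ?sqr_ge0 //.
by rewrite !sqrf_eq0 andbA.
Qed.

(** The symbols multiply to -1 except at frequency zero, where the product is 0 but the coefficient
    [mean f] is 0 as well. *)
Lemma Lap_invmLap (K : nat) (f : gf K) :
  mean f = 0 -> Lap (invmLap f) = gscale (-1) f.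
Proof.
move=> mean0; rewrite -[in RHS](fmult1 K f) -fmult_symbolZ.
rewrite [LHS]fmult_comp; last first.
  move=> p q r; rewrite !symbE !freq_rev !sqrrN !oppr_eq0.
  by case: ifP => _; rewrite ?conjc0 ?conjc_real.
apply: eq_fmult => p q r; case: ifPn => [/and3P[/eqP p0 /eqP q0 /eqP r0]|s0].
  by rewrite dft_freq0 // mean0 !mulr0.
by rewrite -rmorphM /= mulNr mulfV ?symb_neq0 // mulr1.
Qed.

Local Arguments EN {K} a%_ring_scope phi.

(** * Energy estimates *)

Lemma mean_gmul (K : nat) (f g : gf K) : mean (gmul f g) = inner f g.
Proof.
rewrite /mean !innerE; congr (_ * _); apply: eq_bigr => x _.
exact: mulr1.
Qed.

Lemma mean_ge0 (K : nat) (f : gf K) : (forall x, 0 <= at3 K R f x) -> 0 <= mean f.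
Proof.
move=> f0; rewrite /mean innerE mulr_ge0 ?hgrid_ge0 //; apply: sumr_ge0 => x _.
by rewrite mulr_ge0 // ler01.
Qed.

Lemma gradD (K : nat) (f g : gf K) :
  grad (gadd f g) = (gadd (Dx f) (Dx g), gadd (Dy f) (Dy g), gadd (Dz f) (Dz g)).
Proof. by rewrite /grad /Dx /Dy /Dz !fmultD. Qed.

Definition quart (K : nat) (f : gf K) : R := inner (vsq (grad f)) (vsq (grad f)).

Lemma inner_nonlin (K : nat) (f g : gf K) (w := vsq (grad f)) :
  inner (nonlin f) g = - (inner (gmul w (Dx f)) (Dx g)
    + inner (gmul w (Dy f)) (Dy g) + inner (gmul w (Dz f)) (Dz g)).
Proof.
rewrite /nonlin /dive !innerDl -/w.
by rewrite {1}/Dx {1}/Dy {1}/Dz !fmult_skew !opprD.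
Qed.

(** Convexity of [|x|^4 / 4] with an explicit remainder: as [(a + b).b = (X - Y + |b|^2) / 2], the
    gap is [(X - Y)^2 / 4 + X |b|^2 / 2]. *)
Lemma quartic_convex (a1 a2 a3 b1 b2 b3 : R)
    (X := (a1 + b1) * (a1 + b1) + (a2 + b2) * (a2 + b2) + (a3 + b3) * (a3 + b3))
    (Y := a1 * a1 + a2 * a2 + a3 * a3) :
  0 <= X * (a1 + b1) * b1 + X * (a2 + b2) * b2 + X * (a3 + b3) * b3
       - 4^-1 * (X * X - Y * Y).
Proof.
have X0 : 0 <= X by rewrite !addr_ge0 // -expr2 sqr_ge0.
have B0 : 0 <= b1 * b1 + b2 * b2 + b3 * b3 by rewrite !addr_ge0 // -expr2 sqr_ge0.
have -> : X * (a1 + b1) * b1 + X * (a2 + b2) * b2 + X * (a3 + b3) * b3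
       - 4^-1 * (X * X - Y * Y)
   = 4^-1 * (X - Y) ^+ 2 + 2^-1 * (X * (b1 * b1 + b2 * b2 + b3 * b3)).
  by rewrite /X /Y; field.
apply: addr_ge0; apply: mulr_ge0; rewrite ?invr_ge0 ?ler0n ?sqr_ge0 //.
exact: mulr_ge0.
Qed.

Lemma quart_convex (K : nat) (p d : gf K) :
  4^-1 * (quart K (gadd p d) - quart K p) <= - inner (nonlin (gadd p d)) d.
Proof.
pose w := vsq (grad (gadd p d)); pose v := vsq (grad p).
(* The pointwise convexity gap; its mean is the difference of the two sides after integration by
   parts. *)
pose e := gsub (gadd (gadd (gmul (gmul w (gadd (Dx p) (Dx d))) (Dx d))
    (gmul (gmul w (gadd (Dy p) (Dy d))) (Dy d)))
    (gmul (gmul w (gadd (Dz p) (Dz d))) (Dz d)))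
  (gscale 4^-1 (gsub (gmul w w) (gmul v v))).
have e0 : 0 <= mean e.
  apply: mean_ge0 => x; rewrite /e /w gradD.
  exact: (quartic_convex (at3 K R (Dx p) x) (at3 K R (Dy p) x) (at3 K R (Dz p) x)
    (at3 K R (Dx d) x) (at3 K R (Dy d) x) (at3 K R (Dz d) x)).
rewrite /mean /e !inner_lin -!/(mean _) !mean_gmul in e0.
rewrite inner_nonlin opprK -/w; move: e0.
have -> : Dx (gadd p d) = gadd (Dx p) (Dx d) by exact: fmultD.
have -> : Dy (gadd p d) = gadd (Dy p) (Dy d) by exact: fmultD.
have -> : Dz (gadd p d) = gadd (Dz p) (Dz d) by exact: fmultD.
by rewrite subr_ge0.
Qed.

(** [Num.sqrt] is 0 on negative numbers, so removing the root from each norm requires a nonnegative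
    radicand. *)
Lemma norm2_sqr (K : nat) (f : gf K) : norm2 f ^+ 2 = inner f f.
Proof. by rewrite sqr_sqrtr ?inner_ge0. Qed.

Lemma vnorm2_grad_sqr (K : nat) (f : gf K) : vnorm2 (grad f) ^+ 2 = ginner K f f.
Proof.
have E : vnorm2 (grad f) = Num.sqrt (mean (vsq (grad f))).
  congr (Num.sqrt (_ * _)); apply: eq_bigr => i _; apply: eq_bigr => j _.
  by apply: eq_bigr => k _; exact/esym/mulr1.
have -> : ginner K f f = mean (vsq (grad f)).
  by rewrite /mean !innerDl -!/(mean _) !mean_gmul.
have sq_ge0 (y : R) : 0 <= y * y by rewrite -expr2 sqr_ge0.
rewrite E sqr_sqrtr //; apply: mean_ge0 => x.
exact: addr_ge0 (addr_ge0 (sq_ge0 _) (sq_ge0 _)) (sq_ge0 _).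
Qed.

Lemma vnorm4_grad_exp4 (K : nat) (f : gf K) : vnorm4 (grad f) ^+ 4 = quart K f.
Proof.
have -> : vnorm4 (grad f) = Num.sqrt (Num.sqrt (quart K f)) by [].
by rewrite (exprM _ 2 2) !sqr_sqrtr ?sqrtr_ge0 ?inner_ge0.
Qed.

Lemma ENE (K : nat) (a : R) (f : gf K) :
  EN a f = 4^-1 * quart K f + a / 2 * inner f f - ginner K f f
           + 2^-1 * inner (Lap f) (Lap f).
Proof.
by rewrite -vnorm4_grad_exp4 -norm2_sqr -vnorm2_grad_sqr -norm2_sqr.
Qed.

(** Writing [g] as [- Lap (invmLap g)] exhibits the form behind [normm1] as a gradient product,
    which gives its nonnegativity and its Young inequality. *)
Lemma inner_invmLap (K : nat) (f g : gf K) : mean g = 0 ->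
  inner g (invmLap f) = ginner K (invmLap g) (invmLap f).
Proof.
move=> mean0; apply: oppr_inj; rewrite -inner_Lap Lap_invmLap //.
by rewrite innerZl mulN1r.
Qed.

Lemma normm1_sqr (K : nat) (f : gf K) :
  mean f = 0 -> normm1 f ^+ 2 = inner f (invmLap f).
Proof. by move=> f0; rewrite sqr_sqrtr // inner_invmLap ?ginner_ge0. Qed.

(** With [X], [Y], [Z] as named in the proof, [Z <= (X + Y) / 2] gives
    [3/2 X - 1/2 Z >= X + (X - Y) / 4]. The last term telescopes and explains the weight
    [1 / (4 dt)] in the modified energies. *)
Lemma bdf2_test (K : nat) (dt : R) (d d' m : gf K) : 0 < dt ->
  mean d = 0 -> mean d' = 0 ->
  gscale dt^-1 (gsub (gscale (3 / 2) d) (gscale 2^-1 d')) = Lap m ->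
  inner m d <= - (dt^-1 * inner d (invmLap d))
    - 4^-1 * dt^-1 * (inner d (invmLap d) - inner d' (invmLap d')).
Proof.
move=> dt0 d0 d'0 /(congr1 (fun f => inner f (invmLap d))).
rewrite Lap_sym Lap_invmLap // !inner_lin.
have := ginner_le K (invmLap d') (invmLap d); rewrite -!inner_invmLap //.
have t0 : 0 < dt^-1 by rewrite invr_gt0.
move=> /(ler_wpM2l (ltW t0)); set X := inner d _; set Y := inner d' (invmLap d').
set Z := inner d' _; set M := inner m d; set t := dt^-1; lra.
Qed.

(* The square [|u - c d|^2 >= 0] in the gradient seminorm, where [u] solves
   [- Lap u = d] and [c = eps dt / 4], is the AM-GM inequality
   [eps / 2 <= 1 / (dt l) + A dt l] summed over the eigenvalues [l] of [- Lap]. *)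
Lemma interpolation (K : nat) (dt eps A : R) (d : gf K) : 0 < dt ->
  mean d = 0 -> eps ^+ 2 / 16 <= A ->
  eps / 2 * inner d d <= dt^-1 * inner d (invmLap d) + A * dt * ginner K d d.
Proof.
move=> dt0 d0 hA; set u := invmLap d.
have ud : ginner K u d = inner d d.
  by apply: oppr_inj; rewrite -inner_Lap Lap_invmLap // innerZl mulN1r.
have t0 : 0 < dt^-1 by rewrite invr_gt0.
have := ginner_ge0 K (gsub u (gscale (eps * dt / 4) d)).
rewrite !ginner_lin (ginnerC _ d u) ud -inner_invmLap // -/u.
move=> /(mulr_ge0 (ltW t0)).
have := ler_wpM2r (mulr_ge0 (ltW dt0) (ginner_ge0 K d)) hA.
set X := inner d u; set S := inner d d; set G := ginner K d d.
have -> : dt^-1 * (X - eps * dt / 4 * S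
    - (eps * dt / 4 * S - eps * dt / 4 * (eps * dt / 4 * G)))
  = dt^-1 * X - eps / 2 * S + eps ^+ 2 / 16 * (dt * G).
  by field; rewrite gt_eqF.
rewrite mulrA => h1 h2; lra.
Qed.

Lemma onepLap_ge0 (K : nat) (d : gf K) :
  0 <= inner d d - 2 * ginner K d d + inner (Lap d) (Lap d).
Proof.
have := inner_ge0 K (onepLap d); rewrite /onepLap !inner_lin (innerC _ d).
by rewrite inner_Lap => h; lra.
Qed.

(** * The one-step energy inequality *)

Lemma modE1E (K : nat) (eps dt : R) (f g : gf K) : mean (gsub f g) = 0 ->
  modE1 eps dt f g = EN (1 - eps) f
    + 4^-1 * dt^-1 * inner (gsub f g) (invmLap (gsub f g))
    + ginner K (gsub f g) (gsub f g).
Proof. by move=> m0; rewrite -normm1_sqr // -vnorm2_grad_sqr -invfM. Qed.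

Lemma modE2E (K : nat) (eps dt : R) (f g : gf K) : mean (gsub f g) = 0 ->
  modE2 eps dt f g = EN (1 - eps) f
    + 4^-1 * dt^-1 * inner (gsub f g) (invmLap (gsub f g))
    + eps / 2 * inner (gsub f g) (gsub f g).
Proof. by move=> m0; rewrite -normm1_sqr // -norm2_sqr -invfM. Qed.

Lemma inner_mu1 (K : nat) (eps A dt : R) (pn p pp d : gf K) :
  inner (mu1 eps A dt pn p pp) d = - inner (nonlin pn) d + (1 - eps) * inner pn d
    + 2 * inner (Lap (gsub (gscale 2 p) pp)) d
    - A * dt * inner (Lap (gsub pn p)) d + inner (Lap pn) (Lap d).
Proof.
rewrite /mu1 4!innerDl 4!innerZl (Lap_sym _ (Lap pn)).
congr (_ + _ + _ + _ + _); [exact: mulN1r | exact: mulNr].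
Qed.

Lemma inner_mu2 (K : nat) (eps A dt : R) (pn p pp d : gf K) :
  inner (mu2 eps A dt pn p pp) d = - inner (nonlin pn) d
    - eps * inner (gsub (gscale 2 p) pp) d
    - A * dt * inner (Lap (gsub pn p)) d
    + (inner pn d + 2 * inner (Lap pn) d + inner (Lap pn) (Lap d)).
Proof.
rewrite /mu2 3!innerDl 3!innerZl.
congr (_ + _ + _ + _); [exact: mulN1r | exact: mulNr | exact: mulNr |].
rewrite /onepLap innerDl (Lap_sym _ (gadd pn _)) !innerDl -(Lap_sym _ pn d); ring.
Qed.

Lemma gsub_addKl (K : nat) (f g : gf K) : gsub (gadd f g) f = g.
Proof. by apply: at3_ext => x; rewrite -[RHS](addKr (at3 K R f x)) addrC. Qed.

Lemma gsub_subK (K : nat) (f g : gf K) : gsub f (gsub f g) = g.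
Proof. by apply: at3_ext => x; exact: subKr. Qed.

Lemma gadd_subK (K : nat) (f g : gf K) : gadd f (gsub g f) = g.
Proof. by apply: at3_ext => x; exact: subrKC. Qed.

(** The explicit term thus equals [p] plus the previous increment, so its only indefinite
    contribution is a product of [d'] and [d]. *)
Lemma extrapolation (K : nat) (p d' : gf K) :
  gsub (gscale 2 p) (gsub p d') = gadd p d'.
Proof.
apply: at3_ext => x.
transitivity (2 * at3 K R p x - (at3 K R p x - at3 K R d' x)); first by [].
transitivity (at3 K R p x + at3 K R d' x); last by [].
ring.
Qed.

(** Consecutive iterates are written [p + d], [p], [p - d']. After expansion both schemes leave the
    same dissipation: the gap in [interpolation] plus half of [|d + Lap d|^2]. *)
Lemma modE_step (K : nat) (dt eps A : R) (idx : nat) (p d d' : gf K) :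
  0 < dt -> 0 < eps -> eps ^+ 2 / 16 <= A -> mean d = 0 -> mean d' = 0 ->
  gscale dt^-1 (gsub (gscale (3 / 2) d) (gscale 2^-1 d'))
    = Lap (mu idx eps A dt (gadd p d) p (gsub p d')) ->
  modE idx eps dt (gadd p d) p <= modE idx eps dt p (gsub p d').
Proof.
move=> dt0 eps0 hA d0 d'0 /(bdf2_test K dt d d' _ dt0 d0 d'0).
have := interpolation K dt eps A d dt0 d0 hA.
have := onepLap_ge0 K d; have := quart_convex K p d.
rewrite /mu /modE; case: ifP => _.
  (* Bounds the cross term of the explicit Laplacian; the gradient term added in [modE1] absorbs the
     resulting contribution of [d']. *)
  have := ginner_le K d' d.
  rewrite !modE1E ?gsub_addKl ?gsub_subK // !ENE inner_mu1 extrapolation gsub_addKl.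
  rewrite !(inner_Lap _ _ d) !ginner_lin LapD.
  set NL := inner (nonlin _) _.
  rewrite !inner_lin (innerC _ d p) (ginnerC _ d p) (innerC _ (Lap d) (Lap p)).
  lra.
(* Here the cross term is [eps <d', d>], absorbed by the term [eps / 2 |d|^2] of [modE2]. *)
have := ler_wpM2l (ltW eps0) (inner_le K d' d).
rewrite !modE2E ?gsub_addKl ?gsub_subK // !ENE inner_mu2 extrapolation gsub_addKl.
rewrite !(inner_Lap _ _ d) !ginner_lin LapD.
set NL := inner (nonlin _) _.
rewrite !inner_lin (innerC _ d p) (ginnerC _ d p) (innerC _ (Lap d) (Lap p)).
lra.
Qed.

(* phi : int -> gf K; phi n is phi^n (only n >= -1 matters). *)
Theorem theorem3p2 (K : nat) (dt eps A : R) (idx : nat) (phi : int -> gf K) :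
  0 < dt -> 0 < eps -> eps < 1 -> eps ^+ 2 / 16 <= A ->
  (idx = 1 \/ idx = 2)%N ->
  mean (phi (-1)) = mean (phi 0) ->
  (forall k : nat, forall i j l : 'I_(Ngrid K),
     (3 / 2 * phi (k%:Z + 1) i j l - 2 * phi k%:Z i j l + 2^-1 * phi (k%:Z - 1) i j l)
       / dt
     = Lap (mu idx eps A dt (phi (k%:Z + 1)) (phi k%:Z) (phi (k%:Z - 1))) i j l) ->
  forall k : nat, (1 <= k)%N ->
    modE idx eps dt (phi (k%:Z + 1)) (phi k%:Z)
    <= modE idx eps dt (phi k%:Z) (phi (k%:Z - 1)).
Proof.
move=> dt0 eps0 _ hA _ mean0 scheme k _.
pose d (n : int) := gsub (phi (n + 1)) (phi n).
have stepE (n : nat) : gscale dt^-1 (gsub (gscale (3 / 2) (d n%:Z))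
    (gscale 2^-1 (d (n%:Z - 1))))
  = Lap (mu idx eps A dt (phi (n%:Z + 1)) (phi n%:Z) (phi (n%:Z - 1))).
  apply: at3_ext => -[[i j] l]; rewrite /at3 -scheme /d subrK.
  transitivity (dt^-1 * (3 / 2 * (phi (n%:Z + 1) i j l - phi n%:Z i j l)
    - 2^-1 * (phi n%:Z i j l - phi (n%:Z - 1) i j l))); first by [].
  by field; rewrite gt_eqF.
(* Averaging the scheme makes the mean of each increment a third of the preceding one; the induction
   starts at [d (-1)], whose mean is zero by the assumption on the initial data. *)
have mean_d (n : nat) : mean (d n%:Z) = 0 /\ mean (d (n%:Z - 1)) = 0.
  have meanS (m : nat) : mean (d (m%:Z - 1)) = 0 -> mean (d m%:Z) = 0.
    move=> m0; have := mean_Lap K (mu idx eps A dt (phi (m%:Z + 1)) (phi m%:Z)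
      (phi (m%:Z - 1))).
    rewrite -stepE /mean innerZl innerBl !innerZl -!/(mean _) m0 mulr0 subr0 => /eqP.
    have c0 : dt^-1 * (3 / 2) != 0 by rewrite gt_eqF // mulr_gt0 ?invr_gt0 // divr_gt0.
    by rewrite mulrA mulf_eq0 (negPf c0) => /eqP.
  elim: n => [|n [IH _]].
    have m0 : mean (d (0%:Z - 1)) = 0.
      by rewrite /d subrK sub0r /mean innerBl -!/(mean _) mean0 subrr.
    by split=> //; exact: meanS.
  have e : n.+1%:Z - 1 = n%:Z by rewrite intS addrC addKr.
  by split; [apply: meanS|]; rewrite e.
have [dk0 dk'0] := mean_d k.
have e1 : gadd (phi k%:Z) (d k%:Z) = phi (k%:Z + 1) by exact: gadd_subK.
have e2 : gsub (phi k%:Z) (d (k%:Z - 1)) = phi (k%:Z - 1).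
  by rewrite /d subrK; exact: gsub_subK.
have := modE_step K dt eps A idx (phi k%:Z) _ _ dt0 eps0 hA dk0 dk'0.
by rewrite e1 e2; apply; exact: stepE.
Qed.
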